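(* For every finite simple graph $G$ with minimum degree $\delta(G)\ge 2$, $\mathrm{Maj}(G)\le 2\Delta(G)+1$, where $\Delta(G)$ is the maximum degree. Moreover, for infinitely many integers $\Delta$ there exist graphs $G$ with $\Delta(G)=\Delta$ and $\mathrm{Maj}(G)=2\Delta(G)+1$.
   Context: Graphs are finite, simple and undirected. A strong majority vertex-coloring of a graph $G=(V,E)$ is a (not necessarily proper) map $c:V\to C$ into a set $C$ of colors such that for every vertex $v\in V$ and every color $\alpha\in C$, at most half of the neighbors of $v$ have color $\alpha$. The strong majority number $\mathrm{Maj}(G)$ is the least number of colors in such a coloring; it is defined for graphs with minimum degree at least $2$. *)

(* Defs.v *)
From mathcomp Require Import all_boot.

Set Implicit Arguments.
Unset Strict Implicit.
Unset Printing Implicit Defensive.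

Record sgraph := SGraph {
  vertex :> finType;
  adj : rel vertex;
  adj_sym : symmetric adj;
  adj_irr : irreflexive adj
}.

Definition neighbors (G : sgraph) (v : G) : {set G} := [set u | adj v u].

Definition deg (G : sgraph) (v : G) : nat := #|neighbors v|.

Definition max_deg (G : sgraph) : nat := \max_(v : G) deg v.

(** Every degree is smaller than the order of the graph, so the default value
    is irrelevant as soon as there is a vertex; the null graph gets the
    value 0. *)
Definition min_deg (G : sgraph) : nat := \big[minn/#|G|]_(v : G) deg v.

(** Cleared of the division: at most half of the neighbors have color [a]. *)
Definition strong_majority (G : sgraph) (C : finType) (c : {ffun G -> C}) :
    bool :=
  [forall v : G, forall a : C,
     2 * #|[set u in neighbors v | c u == a]| <= deg v].

Definition maj_colorable (G : sgraph) (k : nat) : bool :=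
  [exists c : {ffun G -> 'I_k}, strong_majority c].

Lemma min_deg_le (G : sgraph) (v : G) : min_deg G <= deg v.
Proof.
rewrite /min_deg; have := mem_index_enum v.
elim: (index_enum _) => // x s IHs; rewrite inE big_cons geq_min.
by case/orP => [/eqP-> | /IHs ->]; rewrite ?leqnn ?orbT.
Qed.

Lemma maj_colorable_ex (G : sgraph) :
  2 <= min_deg G -> exists k, maj_colorable G k.
Proof.
move=> dG; exists #|G|; apply/existsP; exists [ffun u => enum_rank u].
apply/forallP => v; apply/forallP => a.
apply: leq_trans (leq_trans dG (min_deg_le v)).
rewrite -[leqRHS](muln1 2) leq_mul2l /= -(cards1 (enum_val a)).
apply/subset_leq_card/subsetP => u; rewrite !inE ffunE => /andP[_ /eqP <-].
by rewrite enum_rankK.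
Qed.

(** The least number of colors; the argument [dG] ensures that some strong
    majority coloring exists, and the value does not depend on it. *)
Definition Maj (G : sgraph) (dG : 2 <= min_deg G) : nat :=
  ex_minn (maj_colorable_ex dG).

(* Main.v *)
(** Upper bound: split every neighborhood into pairs, plus one triple if the
    degree is odd, and let two vertices conflict when they lie in a common part
    of some neighborhood.  A vertex has at most two conflicts for each of its
    neighbors, so the conflict graph has maximum degree at most [2 * Delta] and
    is greedily colored with [2 * Delta + 1] colors; each color then meets each
    of the [deg v / 2] parts at [v] at most once.

    Sharpness: take the point-block incidence graph of a Steiner triple system
    on [n] points.  Points have degree [(n - 1) / 2] and blocks have degree 3,
    so the points of a block get distinct colors; as any two points lie in a
    block, [n = 2 * Delta + 1] colors are needed.  The lines of the affine
    spaces over the field with three elements provide infinitely many systems.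
*)

Require Import Defs.
From mathcomp Require Import all_boot.
From mathcomp Require Import ssralg finalg zmodp matrix zify.

Set Implicit Arguments.
Unset Strict Implicit.
Unset Printing Implicit Defensive.

(** * Upper bound: greedy coloring and the conflict graph *)

Lemma greedy_coloring (T : finType) (H : rel T) (d : nat) :
    symmetric H -> irreflexive H -> (forall x, #|[set y | H x y]| <= d) ->
  exists c : {ffun T -> 'I_d.+1}, forall x y, H x y -> c x != c y.
Proof.
move=> Hsym Hirr Hd.
suff [c Hc] : exists c : {ffun T -> 'I_d.+1},
    {in enum T &, forall x y, H x y -> c x != c y}.
  by exists c => x y; apply: Hc; rewrite mem_enum.
elim: (enum T) => [|a s [c IHc]]; first by exists [ffun=> ord0].
(* All neighbors of [a] are avoided, colored so far or not: they carry at most [d] of the [d.+1]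
   colors. *)
have [k Hk] : exists k, k \notin c @: [set y | H a y].
  apply/existsP; rewrite -negb_forall; apply/negP => /forallP Hall.
  have: #|'I_d.+1| <= #|c @: [set y | H a y]|.
    by apply/subset_leq_card/subsetP => k _; apply: Hall.
  by rewrite card_ord ltnNge (leq_trans (leq_imset_card _ _)).
have fresh y : H a y -> k != c y.
  by move=> Hay; apply: contraNneq Hk => ->; rewrite imset_f ?inE.
exists [ffun x => if x == a then k else c x] => x y; rewrite !inE !ffunE.
case: (eqVneq x a) => [->|_] /=; case: (eqVneq y a) => [->|_] /=.
- by rewrite Hirr.
- by move=> _ _; apply: fresh.
- by move=> _ _; rewrite Hsym eq_sym; apply: fresh.
- exact: IHc.
Qed.

(** Index of the part of [x] when the enumeration of [A] is cut into consecutive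
    pairs, the last part absorbing a leftover element. *)
Definition part (T : finType) (A : {set T}) (x : T) : nat :=
  minn (index x (enum A))./2 (#|A|./2).-1.

Lemma part_lt (T : finType) (A : {set T}) (x : T) :
  2 <= #|A| -> part A x < #|A|./2.
Proof. by rewrite /part; lia. Qed.

(** Indices in part [k] are [2 * k] and [2 * k + 1], plus [2 * k + 2] when the last part absorbs a
    leftover. *)
Lemma card_part (T : finType) (A : {set T}) (k : nat) :
  #|[set x in A | part A x == k]| <= 3.
Proof.
set B := [set x in A | _].
have idx x : x \in B -> 2 * k <= index x (enum A) < 2 * k + 3.
  rewrite inE => /andP[xA].
  have : index x (enum A) < #|A| by rewrite cardE index_mem mem_enum.
  by rewrite /part => ? /eqP; lia.
pose offset x : 'I_3 := inord (index x (enum A) - 2 * k).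
have inj : {in B &, injective offset}.
  move=> x y xB yB /(congr1 val); have := idx x xB; have := idx y yB.
  rewrite /= => iy ix; rewrite !inordK; [|lia|lia] => eq_i.
  move: xB yB; rewrite !inE -!(mem_enum A) => /andP[xA _] /andP[yA _].
  by apply: (index_inj x xA yA); lia.
by rewrite -(card_in_imset inj) -[leqRHS](card_ord 3) max_card.
Qed.

Lemma maj_colorable_max_deg (G : sgraph) :
  2 <= min_deg G -> maj_colorable G (2 * max_deg G).+1.
Proof.
move=> dG.
pose conflict : rel G := fun x y => (x != y) &&
  [exists v, [&& adj v x, adj v y &
    part (neighbors v) x == part (neighbors v) y]].
have conflict_sym : symmetric conflict.
  move=> x y; rewrite /conflict eq_sym; congr (_ && _).
  by apply: eq_existsb => v; rewrite andbCA eq_sym.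
have conflict_irr : irreflexive conflict by move=> x; rewrite /conflict eqxx.
have conflict_deg x : #|[set y | conflict x y]| <= 2 * max_deg G.
  pose near v := [set y in neighbors v |
    part (neighbors v) y == part (neighbors v) x].
  have sub : [set y | conflict x y] \subset
      \bigcup_(v in neighbors x) (near v :\ x).
    apply/subsetP => y; rewrite inE => /andP[xy /existsP[v /and3P[vx vy eq_p]]].
    apply/bigcupP; exists v; rewrite !inE; first by rewrite adj_sym.
    by rewrite eq_sym xy vy eq_sym.
  apply: leq_trans (subset_leq_card sub) _.
  apply: leq_trans (_ : \sum_(v in neighbors x) 2 <= _); last first.
    by rewrite sum_nat_const mulnC leq_mul2l (leq_bigmax x).
  elim/big_rec2: _ => [|v m B vx IH]; first by rewrite cards0.
  apply: leq_trans (leq_card_setU _ _) _; apply: leq_add => //.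
  (* The part of [x] at [v] has at most 3 elements, one of them [x] itself, which leaves 2
     conflicts. *)
  have := card_part (neighbors v) (part (neighbors v) x).
  rewrite -/(near v) (cardsD1 x) !inE adj_sym.
  by rewrite inE in vx; rewrite vx eqxx.
have [c proper] := greedy_coloring conflict_sym conflict_irr conflict_deg.
apply/existsP; exists c; apply/forallP => v; apply/forallP => a.
set M := [set u in _ | _].
have deg_v : 2 <= #|neighbors v| := leq_trans dG (min_deg_le v).
(* Two distinct vertices of color [a] in one part would conflict, so the color class injects into
   the set of parts. *)
have inj : {in M &, injective (fun x => Ordinal (part_lt x deg_v))}.
  move=> x y; rewrite !inE => /andP[vx /eqP cx] /andP[vy /eqP cy].
  move=> /(congr1 val) /= eq_p.
  apply/eqP/contraT => xy; have: c x != c y.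
    apply: proper; rewrite /conflict xy; apply/existsP; exists v.
    by rewrite vx vy eq_p eqxx.
  by rewrite cx cy eqxx.
have: #|M| <= #|neighbors v|./2.
  by rewrite -(card_in_imset inj) -[leqRHS]card_ord max_card.
by rewrite /deg; lia.
Qed.

(** * Incidence graphs of Steiner triple systems *)

Definition steiner_triple_system (T : finType) (S : {set {set T}}) : Prop :=
  {in S, forall B : {set T}, #|B| = 3} /\
  (forall x y : T, x != y -> exists2 B, B \in S & (x \in B) && (y \in B) /\
    {in S, forall B' : {set T}, (x \in B') && (y \in B') -> B' = B}).

Section Incidence.

Variables (T : finType) (S : {set {set T}}).

Definition incidence (u v : T + {B : {set T} | B \in S}) : bool :=
  match u, v with
  | inl x, inr B | inr B, inl x => x \in val B
  | _, _ => false
  end.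

Lemma incidence_sym : symmetric incidence.
Proof. by case=> [x|B] [y|B']. Qed.

Lemma incidence_irr : irreflexive incidence.
Proof. by case. Qed.

Definition incidence_graph : sgraph := SGraph incidence_sym incidence_irr.

Lemma deg_point (x : T) :
  @deg incidence_graph (inl x) = #|[set B in S | x \in B]|.
Proof.
rewrite /deg; pose through := [set b : {B : {set T} | B \in S} | x \in val b].
have -> : @neighbors incidence_graph (inl x) = inr @: through.
  apply/setP => -[y|b]; rewrite inE /=.
    by apply/esym/imsetP => -[].
  by rewrite (mem_imset _ _ inr_inj) inE.
have -> : [set B in S | x \in B] = val @: through.
  apply/setP => B; rewrite inE; apply/andP/imsetP => [[BS xB]|[b]].
    by exists (exist _ B BS); rewrite ?inE.
  by rewrite inE => xb ->; split=> //; apply: valP.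
by rewrite !card_imset //; [apply: val_inj | apply: inr_inj].
Qed.

Lemma neighbors_block (b : {B : {set T} | B \in S}) :
  @neighbors incidence_graph (inr b) = inl @: val b.
Proof.
apply/setP => -[y|b']; rewrite inE /=; first by rewrite (mem_imset _ _ inl_inj).
by apply/esym/imsetP => -[].
Qed.

Lemma deg_block (b : {B : {set T} | B \in S}) :
  @deg incidence_graph (inr b) = #|val b|.
Proof. by rewrite /deg neighbors_block card_imset //; apply: inl_inj. Qed.

Hypothesis STS : steiner_triple_system S.

(* Count in two ways the pairs [(y, B)] with [y != x] and [x, y] in [B]. *)
Lemma steiner_card_blocks (x : T) :
  (2 * #|[set B in S | x \in B]|).+1 = #|T|.
Proof.
have [cardB pairB] := STS.
rewrite (cardD1 x) inE add1n; congr _.+1.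
have -> : 2 * #|[set B in S | x \in B]| =
    \sum_(B in [set B in S | x \in B]) \sum_(y | y != x) (y \in B).
  rewrite mulnC -sum_nat_const; apply: eq_bigr => B.
  rewrite inE => /andP[BS xB].
  have := cardB B BS; rewrite (cardsD1 x) xB => -[<-].
  rewrite -sum1_card -big_mkcondr /=.
  by apply: eq_bigl => y; rewrite !inE.
rewrite exchange_big -sum1_card; apply: eq_big => [y|y yx].
  by rewrite !inE andbT.
have [B BS [/andP[xB yB] uniqB]] := pairB x y (contra_neq esym yx).
rewrite (bigD1 B) /= ?inE ?BS // yB big1 // => B' /andP[].
rewrite inE => /andP[B'S xB'] B'B; apply/eqP; rewrite eqb0.
by apply: contra B'B => yB'; apply/eqP/uniqB; rewrite ?xB'.
Qed.

(** Two points of equal color would be 2 of the 3 neighbors of their common block, more than half;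
    so all points have distinct colors. *)
Lemma maj_colorable_incidence (k : nat) :
  maj_colorable incidence_graph k -> #|T| <= k.
Proof.
case/existsP => c /forallP maj.
suff inj : injective (fun x : T => c (inl x)).
  by rewrite -(card_ord k) -(card_imset _ inj) max_card.
move=> x y eq_c; apply/eqP/contraT => xy.
have [B BS [/andP[xB yB] _]] := STS.2 x y xy.
pose b : {B : {set T} | B \in S} := exist _ B BS.
have /forallP/(_ (c (inl x))) := maj (inr b).
rewrite deg_block (STS.1 _ BS); set M := [set u in _ | _].
suff: #|[set inl x; inl y : incidence_graph]| <= #|M|.
  by rewrite cards2 (inj_eq inl_inj) xy; lia.
apply/subset_leq_card/subsetP => u; rewrite !inE.
by case/orP => /eqP-> /=; rewrite ?xB ?yB ?eq_c eqxx.
Qed.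

(** From 7 points on, point degrees are at least the block degree 3, so the maximum degree is
    attained at points. *)
Hypothesis T_large : 7 <= #|T|.

Lemma deg_point_half (x : T) : @deg incidence_graph (inl x) = #|T|.-1./2.
Proof. by rewrite deg_point -(steiner_card_blocks x); lia. Qed.

Lemma deg_incidence (v : incidence_graph) : 3 <= deg v <= #|T|.-1./2.
Proof.
case: v => [x|b]; first by rewrite deg_point_half; lia.
by rewrite deg_block (STS.1 _ (valP b)); lia.
Qed.

Lemma max_deg_incidence : max_deg incidence_graph = #|T|.-1./2.
Proof.
apply/eqP; rewrite eqn_leq; apply/andP; split.
  by apply/bigmax_leqP => v _; have /andP[] := deg_incidence v.
have /card_gt0P[x _] : 0 < #|T| by lia.
by rewrite -(deg_point_half x) (leq_bigmax (inl x : incidence_graph)).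
Qed.

Lemma min_deg_incidence : 2 <= min_deg incidence_graph.
Proof.
rewrite /min_deg; elim/big_ind: _ => [|m n|v _].
(* The default value of the minimum, the number of vertices, must also be at least 2. *)
- by rewrite card_sum; lia.
- by rewrite leq_min => -> ->.
- by have /andP[/ltnW] := deg_incidence v.
Qed.

Lemma Maj_incidence (dG : 2 <= min_deg incidence_graph) :
  2 * max_deg incidence_graph + 1 <= Maj dG.
Proof.
rewrite max_deg_incidence /Maj; case: ex_minnP => m /maj_colorable_incidence.
have /card_gt0P[x _] : 0 < #|T| by lia.
by have := steiner_card_blocks x; lia.
Qed.

End Incidence.

(** * Steiner triple systems on abelian groups of exponent 3 *)

Section ZeroSumTriples.

Import GRing.Theory.
Local Open Scope ring_scope.

Variable V : finZmodType.

(* These are the affine lines when [x + x + x = 0] for all [x]. *)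
Definition zero_sum_triples : {set {set V}} :=
  [set B : {set V} | (#|B| == 3)%N && (\sum_(z in B) z == 0)].

Lemma steiner_zero_sum_triples :
  (forall x : V, x + x + x = 0) -> steiner_triple_system zero_sum_triples.
Proof.
move=> V3; split=> [B|x y xy]; first by rewrite inE => /andP[/eqP].
(* The zero sum forces this third point of the block through [x] and [y]. *)
pose z := - (x + y).
(* Equality would give [u + u + v = 0 = u + u + u], hence [v = u]. *)
have third (u v : V) : u != v -> - (u + v) != u.
  apply: contraNneq => uvu; rewrite -(inj_eq (addrI (u + u))) V3.
  by rewrite -{1}uvu -addrA addNr.
have zx : z != x by apply: third.
have zy : z != y by rewrite /z addrC third // eq_sym.
exists (x |: (y |: [set z])).
  have xN : x \notin y |: [set z] by rewrite !inE negb_or xy eq_sym.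
  have yN : y \notin [set z] by rewrite inE eq_sym.
  rewrite inE !cardsU1 cards1 xN yN !big_setU1 //= big_set1.
  by rewrite addrA subrr.
rewrite !inE !eqxx orbT; split=> // B.
rewrite inE => /andP[/eqP cardB /eqP sumB] /andP[xB yB].
have yBx : y \in B :\ x by rewrite !inE eq_sym xy.
move: cardB; rewrite (cardsD1 x) xB (cardsD1 y) yBx => -[/eqP/cards1P[w Bw]].
move: sumB; rewrite (big_setD1 x) // (big_setD1 y) //= Bw big_set1 addrA.
move/eqP; rewrite addr_eq0 eq_sym eqr_oppLR => /eqP wz.
by rewrite -(setD1K xB) -(setD1K yBx) Bw wz.
Qed.

End ZeroSumTriples.

Theorem theorem7 :
  (forall (G : sgraph) (dG : 2 <= min_deg G), Maj dG <= 2 * max_deg G + 1)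
  /\
  (forall N : nat, exists D : nat, N <= D /\
     exists (G : sgraph) (dG : 2 <= min_deg G),
       max_deg G = D /\ Maj dG = 2 * max_deg G + 1).
Proof.
have upper (G : sgraph) (dG : 2 <= min_deg G) : Maj dG <= 2 * max_deg G + 1.
  rewrite /Maj addn1; case: ex_minnP => m _; apply.
  exact: maj_colorable_max_deg.
(* Dimension at least 2 gives at least 9 points, enough for [V_large]; the degree
   [(3 ^ N.+2 - 1) / 2] exceeds [N]. *)
split=> // N; pose V : finZmodType := 'rV['Z_3]_N.+2.
have V3 (x : V) : (x + x + x = 0)%R.
  apply/matrixP => i j; rewrite !mxE.
  by case: (x i j) => -[|[|[|]]] // ?; apply: val_inj.
have cardV : #|V| = 3 ^ N.+2 by rewrite card_mx card_ord mul1n.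
have V_large : 7 <= #|V| by rewrite cardV !expnS; have := expn_gt0 3 N; lia.
have STS := steiner_zero_sum_triples V3.
exists #|V|.-1./2; split.
  by rewrite cardV !expnS; have := ltn_expl N (isT : 1 < 3); lia.
have dG := min_deg_incidence STS V_large.
exists (incidence_graph (zero_sum_triples V)), dG.
split; first exact: max_deg_incidence.
by apply/eqP; rewrite eqn_leq upper Maj_incidence.
Qed.
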